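(* For every finite poset $P$ there is a constant $C$ (depending only on $P$) such that for every positive integer $n$, every family $\mathcal{F}$ of subsets of $[n]$ that does not contain an induced copy of $P$ satisfies $$|\mathcal{F}| \le C\binom{n}{\lfloor n/2\rfloor}.$$
   Context: $[n]=\{1,2,\ldots,n\}$. A family $\mathcal{F}$ of subsets of $[n]$ contains an induced copy of $P$ (contains $P$ as an induced subposet) if there is an injection $\alpha: P\to\mathcal{F}$ such that for all $x_1,x_2\in P$: $x_1<_P x_2$ if and only if $\alpha(x_1)\subset\alpha(x_2)$ (strict inclusion). *)

(* Defs.v *)
From mathcomp Require Import all_boot all_order.

Set Implicit Arguments.
Unset Strict Implicit.
Unset Printing Implicit Defensive.

Definition contains_induced_copy (d : Order.disp_t) (P : finPOrderType d)
    (n : nat) (F : {set {set 'I_n}}) : Prop :=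
  exists alpha : P -> {set 'I_n},
    [/\ injective alpha,
        forall x : P, alpha x \in F
      & forall x1 x2 : P, (x1 < x2)%O <-> alpha x1 \proper alpha x2].

Arguments contains_induced_copy {d} P {n} F.

(* Main.v *)
Require Import Defs.
From mathcomp Require Import all_boot all_order.
From mathcomp Require Import fingroup perm zify.

Set Implicit Arguments.
Unset Strict Implicit.
Unset Printing Implicit Defensive.

(** Fix linear extensions L_i of P, i in I, such that x <= y in P iff
    L_i x <= L_i y for all i ([linear_extensions]; d = |I| = |P| + 1 of them
    are used).

    Cut a linear order on [n] into blocks indexed by I. A union of initial
    segments of the blocks is encoded by the vector of the segment lengths,
    and inclusion of such unions is the product order on the vectors
    ([nested_blocks]). So if a family F has no induced copy of P, then for
    every permutation of [n] the vectors whose permuted unions lie in F form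
    a subset of the d-dimensional grid of side n + 1 that does not contain P
    as the permutation pattern with coordinate orders L_i. By the
    d-dimensional Marcus-Tardos theorem of Klazar and Marcus
    ([forbidden_pattern_bound]) there are only O(n^(d-1)) such vectors.

    Averaging over all permutations turns this into a bound of LYM type
    ([permutation_averaging]): a set Y in F is hit with probability
    1 / 'C(n, |Y|) by each vector of coordinate sum |Y|. Take |P| short blocks
    of length w of order n / (3 (|P| + 1)) and one block with all the
    remaining positions. For n / 3 <= |Y| <= 2n / 3 the lengths in the short
    blocks are then arbitrary and the last length is determined by them, so
    there are at least (w + 1)^(d-1) vectors of sum |Y| ([many_profiles]).
    Dividing, F has O('C(n, n / 2)) members of these sizes
    ([middle_levels_bound]). The remaining levels hold O('C(n, n / 2)) sets
    altogether, because binomial coefficients grow at least geometrically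
    up to n / 3 ([sum_low_bin]).

    The Marcus-Tardos bound is proved by induction on the dimension and on
    the side. Cut the grid into cubic blocks of constant side s. The nonempty
    blocks form a smaller grid that avoids the pattern as well. A block
    having fewer than k values in every coordinate contains at most k^d
    points. The blocks with at least k values in coordinate i are few: among
    those in the same layer and with the same k values, a pattern in the
    other d - 1 coordinates would extend to a pattern of the points. Since
    k^d < s^(d-1) for large s, the resulting recursion solves to O(m^(d-1)). *)

(** * Forbidden permutation patterns in grids *)

Lemma increasing_enumeration N k (A : {set 'I_N}) : k <= #|A| ->
  exists c : nat -> nat, (forall j, j < k -> exists2 a, a \in A & c j = a)
    /\ (forall j j', j < j' < k -> c j < c j').
Proof.
move=> kA; exists (fun j => nth 0 (map val (enum A)) j); split=> [j jk | j j'].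
  have jA : j < size (map val (enum A)) by rewrite size_map -cardE; exact: leq_trans jk kA.
  case/mapP: (mem_nth 0 jA) => a; rewrite mem_enum => aA ->; by exists a.
case/andP=> jj' j'k; have szA : size (map val (enum A)) = #|A|.
  by rewrite size_map cardE.
have srt : sorted ltn (map val (enum A)).
  rewrite sorted_map {1}/enum_mem; apply: sorted_filter => [x y z /=|].
    exact: ltn_trans.
  rewrite -sorted_map -enumT val_enum_ord; exact: iota_ltn_sorted.
by apply: (sorted_ltn_nth ltn_trans 0 srt) => //; rewrite ?inE szA; lia.
Qed.

Section Grid.
Variables (I P : finType) (L : I -> P -> nat) (k : nat).
Hypothesis Lltk : forall i x, L i x < k.

(** The ambient side M never changes: sides and dimensions of subgrids are
    expressed by membership in [grid], so that rescaling and projection stay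
    within one type. *)
Notation point M := {ffun I -> 'I_M.+1}.

(** Only strict inequalities are demanded, since these are what passes from
    blocks to points chosen inside them. *)
Definition has_pattern (D : {set I}) M (S : {set point M}) : Prop :=
  exists p : P -> point M, (forall x, p x \in S)
    /\ forall i x y, i \in D -> L i x < L i y -> p x i < p y i.

(** The grid of side m in the coordinates of D; the other coordinates are
    below m ^ 0 = 1, hence 0. *)
Definition grid (D : {set I}) M m : {set point M} :=
  [set p : point M | [forall i, p i < m ^ (i \in D)]].

Lemma gridP (D : {set I}) M m (p : point M) :
  reflect (forall i, p i < m ^ (i \in D)) (p \in grid D M m).
Proof. by rewrite inE; apply: forallP. Qed.

Definition coords M (S : {set point M}) i : {set 'I_M.+1} :=
  [set p i | p : point M in S].

Lemma card_le_box (D : {set I}) M (S : {set point M}) (c : nat) :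
  (forall i, #|coords S i| <= c ^ (i \in D)) -> #|S| <= c ^ #|D|.
Proof.
move=> Hc.
have /subset_leq_card /leq_trans -> // : S \subset family (fun i => mem (coords S i)).
  apply/subsetP=> p pS; apply/familyP=> i; exact: imset_f.
have -> : #|D| = \sum_i (i \in D).
  by rewrite -sum1_card big_mkcond; apply: eq_bigr => i _; case: (i \in D).
rewrite card_family foldrE big_map expn_sum big_enum /=.
exact: leq_prod.
Qed.

Lemma coords_inactive (D : {set I}) M m (S : {set point M}) i :
  S \subset grid D M m -> i \notin D -> #|coords S i| <= 1.
Proof.
move=> /subsetP SG iD; rewrite -(cards1 (ord0 : 'I_M.+1)).
apply/subset_leq_card/subsetP=> _ /imsetP[p /SG /gridP/(_ i) + ->].
by rewrite inE (negbTE iD) expn0 ltnS leqn0.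
Qed.

Section Coarse.
Variables (D : {set I}) (s : nat).
Hypothesis s_gt0 : 0 < s.

Definition coarse M (p : point M) : point M := [ffun i => inord (p i %/ s)].

Lemma coarseE M (p : point M) i : coarse p i = p i %/ s :> nat.
Proof.
by rewrite ffunE inordK // (leq_ltn_trans (leq_div _ _)).
Qed.

Lemma coarse_grid M m (p : point M) :
  p \in grid D M (s * m) -> coarse p \in grid D M m.
Proof.
move/gridP=> pG; apply/gridP=> i; rewrite coarseE.
have := pG i; case: (i \in D); first by rewrite !expn1 ltn_divLR // mulnC.
by rewrite !expn0 !ltnS !leqn0 => /eqP->; rewrite div0n.
Qed.

(** Strictly ordered blocks consist of strictly ordered points, so any choice
    of one point per block of the pattern works. *)
Lemma pattern_of_coarse M (S : {set point M}) :
  has_pattern D [set coarse p | p in S] -> has_pattern D S.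
Proof.
case=> q [qS qlt].
have /fin_all_exists[p Hp] x : exists p, p \in S /\ coarse p = q x.
  by case/imsetP: (qS x) => p pS ->; exists p.
exists p; split=> [x|i x y iD Lxy]; first by case: (Hp x).
have := qlt i x y iD Lxy; case: (Hp x) => _ <-; case: (Hp y) => _ <-.
by rewrite !coarseE; apply: contraTltn => /(leq_div2r s); rewrite leqNgt.
Qed.

Definition fiber M (S : {set point M}) b : {set point M} :=
  [set p in S | coarse p == b].

Definition wide M (S : {set point M}) i : {set point M} :=
  [set b in [set coarse p | p in S] | k <= #|coords (fiber S b) i|].

(** Within one block, a coordinate is determined by its offset. *)
Lemma fiber_mod_inj M (S : {set point M}) b i :
  {in coords (fiber S b) i &,
    injective (fun a : 'I_M.+1 => Ordinal (ltn_pmod a s_gt0))}.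
Proof.
move=> _ _ /imsetP[p + ->] /imsetP[q + ->].
rewrite !inE => /andP[_ /eqP pb] /andP[_ /eqP qb] /(congr1 val) /= pq.
apply/val_inj; rewrite /= (divn_eq (p i) s) (divn_eq (q i) s) pq.
by rewrite -!coarseE pb qb.
Qed.

Lemma card_coords_fiber M m (S : {set point M}) b i :
  S \subset grid D M m -> #|coords (fiber S b) i| <= s ^ (i \in D).
Proof.
move=> SG; have [iD|iD] := boolP (i \in D).
  by rewrite expn1 -[s]card_ord -(card_in_imset (@fiber_mod_inj M S b i)) max_card.
have FS : fiber S b \subset S by apply/subsetP=> p; rewrite inE => /andP[].
exact: coords_inactive (subset_trans FS SG) iD.
Qed.

(** A block that is wide in no direction fits in a box of side k, and any block
    in a box of side s. *)
Lemma card_fiber M m (S : {set point M}) b : S \subset grid D M m ->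
  b \in [set coarse p | p in S] ->
  #|fiber S b| <= k ^ #|D| + s ^ #|D| * \sum_(i in D) (b \in wide S i).
Proof.
move=> SG bS; case: (boolP [exists i in D, b \in wide S i]).
  case/exists_inP=> i iD bW; rewrite (bigD1 i) //= bW.
  apply: (@leq_trans (s ^ #|D|)); last by rewrite mulnDr muln1; lia.
  by apply: card_le_box => j; apply: card_coords_fiber SG.
rewrite negb_exists => /forallP nW.
apply: leq_trans (leq_addr _ _); apply: card_le_box => i.
have := nW i; have := card_coords_fiber b i SG; case: (boolP (i \in D)) => //= iD _.
by rewrite inE bS /= -ltnNge expn1 => /ltnW.
Qed.

Lemma card_le_coarse M m (S : {set point M}) : S \subset grid D M m ->
  #|S| <= k ^ #|D| * #|[set coarse p | p in S]|
          + s ^ #|D| * \sum_(i in D) #|wide S i|.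
Proof.
move=> SG; rewrite -sum1_card (partition_big_imset (@coarse M)) /=.
apply: (@leq_trans (\sum_(b in [set coarse p | p in S])
    (k ^ #|D| + s ^ #|D| * \sum_(i in D) (b \in wide S i)))).
  apply: leq_sum => b bS; apply: leq_trans (card_fiber SG bS).
  by rewrite -sum1_card; apply: eq_leq; apply: eq_bigl => p; rewrite inE.
rewrite big_split /= sum_nat_const mulnC leq_add2l -big_distrr /= leq_mul2l.
rewrite exchange_big /= leq_sum ?orbT // => i _.
rewrite -sum1_card [X in _ <= X]big_mkcond /= big_mkcond /=.
by apply: leq_sum => b _; case: ifP => // _; case: (b \in wide S i).
Qed.

Definition collapse i M (p : point M) : point M :=
  [ffun j => if j == i then ord0 else p j].

(** Blocks in the layer v of direction i all contain points with every offset
    in O, so coordinate i can be prescribed freely: along a pattern of the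
    blocks in the other coordinates, choose in the block of x a point whose
    i-th coordinate is the (L i x)-th value available. *)
Lemma pattern_of_wide_blocks M (S : {set point M}) i (v : nat) (O : {set 'I_s})
    (W : {set point M}) :
  i \in D -> k <= #|O| ->
  (forall b, b \in W -> b i = v :> nat) ->
  (forall b o, b \in W -> o \in O ->
     exists p, [/\ p \in S, coarse p = b & p i %% s = o]) ->
  has_pattern (D :\ i) [set collapse i b | b in W] -> has_pattern D S.
Proof.
move=> iD kO Wv WO [q [qW qlt]].
have [c [cO clt]] := increasing_enumeration kO.
have /fin_all_exists[p Hp] x : exists p,
    [/\ p \in S, collapse i (coarse p) = q x & p i = v * s + c (L i x) :> nat].
  have [b bW qb] := imsetP (qW x); have [o oO co] := cO _ (Lltk i x).
  have [p [pS pb po]] := WO _ _ bW oO.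
  exists p; split=> //; first by rewrite pb qb.
  by rewrite (divn_eq (p i) s) -coarseE pb (Wv _ bW) po co.
exists p; split=> [x|j x y jD Lxy]; first by case: (Hp x).
have [ji|ji] := eqVneq j i.
  rewrite ji in Lxy *.
  have [_ _ ->] := Hp x; have [_ _ ->] := Hp y; rewrite ltn_add2l clt //.
  by rewrite Lxy Lltk.
have jDi : j \in D :\ i by rewrite !inE ji.
have := qlt j x y jDi Lxy; have [_ <- _] := Hp x; have [_ <- _] := Hp y.
rewrite ![collapse _ _ _]ffunE (negbTE ji) !coarseE.
by apply: contraTltn => /(leq_div2r s); rewrite leqNgt.
Qed.

Lemma collapse_inj i (v : nat) M (W : {set point M}) :
  (forall b, b \in W -> b i = v :> nat) -> {in W &, injective (@collapse i M)}.
Proof.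
move=> Wv b b' bW b'W /ffunP bb'; apply/ffunP=> j.
have := bb' j; rewrite !ffunE; case: eqP => // -> _.
by apply/val_inj; rewrite /= !Wv.
Qed.

Lemma collapse_grid i M m (b : point M) :
  b \in grid D M m -> collapse i b \in grid (D :\ i) M m.
Proof.
move/gridP=> bG; apply/gridP=> j; rewrite ffunE !inE.
by have := bG j; case: eqP => // _ _; rewrite expn0.
Qed.

(** The wide blocks are sorted by layer and by set of offsets, m * 2 ^ s classes.
    Each class projects injectively to a grid of one dimension less and avoids
    the pattern there. *)
Lemma card_wide M m B (S : {set point M}) i : i \in D ->
  S \subset grid D M (s * m) -> ~ has_pattern D S ->
  (forall W : {set point M}, W \subset grid (D :\ i) M m ->
     ~ has_pattern (D :\ i) W -> #|W| <= B) ->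
  #|wide S i| <= m * 2 ^ s * B.
Proof.
move=> iD /subsetP SG noS IH.
case: m SG IH => [|m] SG IH.
  suff -> : wide S i = set0 by rewrite cards0.
  apply/setP=> b; rewrite !inE; apply/negbTE/negP=> /andP[/imsetP[p pS _] _].
  by have /gridP/(_ i) := SG _ pS; rewrite iD muln0.
pose offs b : {set 'I_s} := [set o : 'I_s | [exists p in fiber S b, p i %% s == o]].
pose key (b : point M) : 'I_m.+1 * {set 'I_s} := (inord (b i), offs b).
have wG b : b \in wide S i -> b \in grid D M m.+1.
  by rewrite !inE => /andP[/imsetP[p /SG pS ->] _]; have := coarse_grid pS; rewrite inE.
have koffs b : b \in wide S i -> k <= #|offs b|.
  rewrite inE => /andP[_ kT]; apply: leq_trans kT _.
  rewrite -(card_in_imset (@fiber_mod_inj M S b i)).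
  apply/subset_leq_card/subsetP=> _ /imsetP[_ /imsetP[p pF ->] ->].
  by rewrite inE; apply/exists_inP; exists p.
rewrite -sum1_card (partition_big key xpredT) //=.
have -> : m.+1 * 2 ^ s * B = \sum_(kk : 'I_m.+1 * {set 'I_s}) B.
  rewrite sum_nat_const card_prod card_ord; congr (_ * _ * _).
  have := card_powerset [set: 'I_s]; rewrite cardsT card_ord => <-.
  by apply: eq_card => A; rewrite !inE subsetT.
apply: leq_sum => -[v O] _.
pose W := [set b in wide S i | key b == (v, O)].
have -> : \sum_(b in wide S i | key b == (v, O)) 1 = #|W|.
  by rewrite -sum1_card; apply: eq_bigl => b; rewrite [RHS]inE.
have Wv b : b \in W -> b i = v :> nat.
  rewrite inE => /andP[/wG /gridP/(_ i) + /eqP[/(congr1 val) /= + _]].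
  by rewrite iD expn1 => bm; rewrite inordK.
rewrite -(card_in_imset (collapse_inj Wv)); apply: IH.
  apply/subsetP=> _ /imsetP[b bW ->]; apply: collapse_grid; apply: wG.
  by move: bW; rewrite inE => /andP[].
have [W0|[b0 b0W]] := set_0Vmem W.
  case=> q [qW _]; apply: noS.
  (* An empty class contains the pattern only if P is empty; nothing is then
     known about O, but any set of points contains the pattern. *)
  have noP (x : P) : False by have := qW x; rewrite W0 imset0 inE.
  by exists (fun x => False_rect _ (noP x)); split=> [x|? x]; case: (noP x).
move=> pat; apply: noS.
apply: (@pattern_of_wide_blocks M S i v O W) => //.
  by move: b0W; rewrite inE => /andP[/koffs + /eqP[_ <-]].
move=> b o; rewrite inE => /andP[_ /eqP[_ <-]]; rewrite inE.
case/exists_inP=> p; rewrite inE => /andP[pS /eqP pb] /eqP po.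
by exists p.
Qed.

End Coarse.

Lemma line_bound (D : {set I}) M m (S : {set point M}) : #|D| = 1 ->
  S \subset grid D M m -> ~ has_pattern D S -> #|S| <= k.
Proof.
move=> D1 SG noS; rewrite -[k]expn1 -D1; apply: card_le_box => i.
have [iD|iD] := boolP (i \in D); last exact: coords_inactive SG iD.
rewrite expn1 leqNgt; apply/negP=> /ltnW kT; apply: noS.
have [c [cT clt]] := increasing_enumeration kT.
have /fin_all_exists[p Hp] x : exists p, p \in S /\ p i = c (L i x) :> nat.
  by have [_ /imsetP[p pS ->] ->] := cT _ (Lltk i x); exists p.
exists p; split=> [x|j x y]; first by case: (Hp x).
have /cards1P[i' Di'] := introT eqP D1.
move: iD; rewrite Di' !inE => /eqP ii' /eqP->; rewrite -ii' => Lxy.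
by rewrite (Hp x).2 (Hp y).2 clt // Lxy Lltk.
Qed.

(** The side of the blocks is (k + 2)^2 because the recursion contracts only if
    k ^ (d + 1) < s ^ d in every dimension d + 1 > 1, where s is that side.
    Powers of s as sides of the grid make all subdivisions exact. *)
Lemma forbidden_pattern_bound d : exists C, forall (D : {set I}) M t (S : {set point M}),
  #|D| = d.+1 -> S \subset grid D M ((k.+2 ^ 2) ^ t) -> ~ has_pattern D S ->
  #|S| <= C * ((k.+2 ^ 2) ^ t) ^ d.
Proof.
set s := k.+2 ^ 2; have s_gt0 : 0 < s by rewrite expn_gt0.
have ks e : k ^ e.+2 < s ^ e.+1.
  apply: (@leq_trans (k.+1 ^ e.+2)); first by rewrite ltn_exp2r.
  rewrite -expnM; apply: (@leq_trans (k.+2 ^ e.+2)); first by rewrite leq_exp2r.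
  by rewrite leq_exp2l //; lia.
clearbody s.
elim: d => [|d [C' IH]].
  by exists k => D M t S D1 SG noS; rewrite expn0 muln1; apply: line_bound SG noS.
(* K bounds the contribution of the wide blocks, so the constant C
   must satisfy k ^ d.+2 * C + K <= s ^ d.+1 * C. *)
pose K := s ^ d.+2 * (d.+2 * (2 ^ s * C')); exists K.+1 => D M t S Dd.
elim: t S => [|t IHt] S SG noS.
  rewrite !exp1n muln1; apply: (@leq_trans 1) => //.
  rewrite -(exp1n #|D|); apply: card_le_box => i; rewrite exp1n.
  rewrite -(cards1 (ord0 : 'I_M.+1)).
  apply/subset_leq_card/subsetP=> _ /imsetP[p /(subsetP SG) /gridP/(_ i) + ->].
  by rewrite inE !exp1n ltnS leqn0.
rewrite expnS in SG.
have coarseB : #|[set coarse s p | p in S]| <= K.+1 * (s ^ t) ^ d.+1.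
  apply: IHt; last by move/pattern_of_coarse/noS.
  by apply/subsetP=> _ /imsetP[p /(subsetP SG) pS ->]; apply: coarse_grid.
have wideB i : i \in D -> #|wide s S i| <= 2 ^ s * C' * (s ^ t) ^ d.+1.
  move=> iD; apply: leq_trans (card_wide s_gt0 iD SG noS (B := C' * (s ^ t) ^ d) _) _.
    move=> W; apply: IH; have := cardsD1 i D; rewrite iD Dd; lia.
  by apply: eq_leq; rewrite [_ ^ d.+1]expnS; lia.
apply: leq_trans (card_le_coarse s_gt0 SG) _; rewrite Dd.
set X := (s ^ t) ^ d.+1 in coarseB wideB *.
have -> : (s ^ t.+1) ^ d.+1 = s ^ d.+1 * X by rewrite [s ^ t.+1]expnS expnMn.
have sumB : \sum_(i in D) #|wide s S i| <= d.+2 * (2 ^ s * C' * X).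
  by rewrite -Dd -sum_nat_const; apply: leq_sum.
apply: (@leq_trans (k ^ d.+2 * (K.+1 * X) + K * X)).
  apply: leq_add; first by rewrite leq_mul2l coarseB orbT.
  have -> : K * X = s ^ d.+2 * (d.+2 * (2 ^ s * C' * X)) by rewrite /K !mulnA.
  by rewrite leq_mul2l sumB orbT.
apply: (@leq_trans ((k ^ d.+2).+1 * (K.+1 * X))).
  by rewrite [leqRHS]mulSn addnC leq_add2r leq_mul2r leqnSn orbT.
by rewrite [leqRHS]mulnCA leq_mul2r ks orbT.
Qed.

End Grid.

(** * Binomial coefficients and extreme levels *)

Lemma bin_le_succ n a : a.*2 < n -> 'C(n, a) <= 'C(n, a.+1).
Proof.
move=> an; rewrite -(leq_pmul2l (ltn0Sn a)) mul_bin_left leq_mul2r.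
by apply/orP; right; lia.
Qed.

Lemma bin_le_half n a b : a <= b <= n %/ 2 -> 'C(n, a) <= 'C(n, b).
Proof.
case/andP; elim: b => [|b IH]; first by rewrite leqn0 => /eqP->.
rewrite leq_eqVlt => /predU1P[-> //|ab] bn.
apply: leq_trans (IH ab (ltnW bn)) (bin_le_succ _); lia.
Qed.

Lemma bin_le_middle n a : 'C(n, a) <= 'C(n, n %/ 2).
Proof.
have [an|an] := leqP a (n %/ 2); first by rewrite bin_le_half // an leqnn.
have [na|na] := ltnP n a; first by rewrite bin_small.
by rewrite -bin_sub // bin_le_half //; lia.
Qed.

(** Up to n / 3 each binomial coefficient is at least twice the preceding one. *)
Lemma sum_low_bin n j : 3 * j <= n.+1 -> \sum_(a < j.+1) 'C(n, a) <= 2 * 'C(n, j).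
Proof.
elim: j => [|j IH] jn; first by rewrite big_ord_recr big_ord0 /= !bin0.
rewrite big_ord_recr /=; apply: leq_trans (leq_add (IH _) (leqnn _)) _; first lia.
suff : 2 * 'C(n, j) <= 'C(n, j.+1) by lia.
rewrite -(leq_pmul2l (ltn0Sn j)) mul_bin_left mulnA leq_mul2r.
by apply/orP; right; lia.
Qed.

Lemma card_low_levels n j (F : {set {set 'I_n}}) : 3 * j <= n.+1 ->
  (forall A, A \in F -> #|A| <= j) -> #|F| <= 2 * 'C(n, n %/ 2).
Proof.
move=> jn Fj; apply: leq_trans (leq_trans (sum_low_bin jn) _); last first.
  by rewrite leq_mul2l bin_le_middle orbT.
rewrite -sum1_card (partition_big (fun A : {set 'I_n} => inord #|A| : 'I_j.+1) xpredT) //=.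
apply: leq_sum => a _; rewrite -[X in 'C(X, _)]card_ord -card_draws -sum1_card.
rewrite big_mkcond [leqRHS]big_mkcond; apply: leq_sum => A _; rewrite inE.
by case: ifP => // /andP[/Fj Aj /eqP <-]; rewrite inordK // eqxx.
Qed.

Lemma card_high_levels n j (F : {set {set 'I_n}}) : 3 * j <= n.+1 ->
  (forall A, A \in F -> n <= #|A| + j) -> #|F| <= 2 * 'C(n, n %/ 2).
Proof.
move=> jn Fj; have := @card_imset _ _ (@setC 'I_n) (mem F) (@setC_inj _).
move<-; apply: card_low_levels jn _ => _ /imsetP[A /Fj Aj ->].
by have := cardsC A; rewrite card_ord; lia.
Qed.

(** * Averaging over permutations *)

Section Permutations.
Variable T : finType.
Implicit Types (X Y : {set T}) (s : {perm T}).

(** Match the enumerations of X followed by its complement and of Y followed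
    by its complement. *)
Lemma perm_between X Y : #|X| = #|Y| -> exists s, s @: X = Y.
Proof.
move=> XY; pose e (Z : {set T}) := enum Z ++ enum (~: Z).
have eT Z x : x \in e Z by rewrite mem_cat !mem_enum inE orbN.
have eU Z : uniq (e Z).
  rewrite cat_uniq !enum_uniq /= andbT; apply/hasPn=> x /=.
  by rewrite !mem_enum inE.
have eS Z : size (e Z) = #|T| by rewrite size_cat -!cardE cardsC.
pose f x := nth x (e Y) (index x (e X)).
have iX x : index x (e X) < #|T| by rewrite -(eS X) index_mem.
have f_inj : injective f.
  move=> x y; rewrite /f (set_nth_default y) ?eS // => /eqP.
  rewrite nth_uniq ?eS // => /eqP xy.
  by rewrite -(nth_index x (eT X x)) xy (set_nth_default y) ?eS ?nth_index.
exists (perm f_inj); apply/eqP; rewrite eqEcard card_imset ?XY ?leqnn ?andbT; last first.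
  exact: perm_inj.
apply/subsetP=> _ /imsetP[x xX ->]; rewrite permE /f -mem_enum.
have iXx : index x (e X) < size (enum Y).
  by rewrite index_cat mem_enum xX -cardE -XY cardE index_mem mem_enum.
by rewrite nth_cat iXx mem_nth.
Qed.

Lemma card_all_perm : #|{: {perm T}}| = #|T|`!.
Proof.
have := card_perm [set: T]; rewrite cardsT => <-; apply: eq_card => s.
by apply/esym/subsetP=> x; rewrite inE.
Qed.

(** By translation, the images of X under a uniform permutation are uniform
    among the 'C(#|T|, #|X|) sets of the same size. *)
Lemma card_perm_between X Y : #|X| = #|Y| ->
  #|[set s : {perm T} | s @: X == Y]| * 'C(#|T|, #|X|) = #|T|`!.
Proof.
move=> XY; rewrite -card_all_perm -[RHS]sum1_card.
rewrite [RHS](partition_big (fun s => s @: X)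
  (mem [set Z : {set T} | #|Z| == #|X|])) /=; last first.
  by move=> s _; rewrite inE card_imset //; apply: perm_inj.
rewrite -card_draws mulnC -sum_nat_const; apply: eq_bigr => Z; rewrite inE => /eqP ZX.
have [r rYZ] : exists r : {perm T}, r @: Y = Z by apply: perm_between; rewrite ZX.
rewrite -sum1_card [RHS](reindex_inj (mulIg r)); apply: eq_bigl => s.
rewrite inE -rYZ; have -> : (s * r)%g @: X = r @: (s @: X).
  by rewrite -imset_comp; apply: eq_imset => x; rewrite permM.
by apply/eqP/eqP=> [-> | /(imset_inj (@perm_inj _ r))].
Qed.

(** Count the pairs (s, q) with s @: A q in F in two ways: each permutation s
    contributes at most b of them, and each Y in F at least
    c * #|T|`! / 'C(#|T|, #|Y|). *)
Lemma permutation_averaging (Q : finType) (G : {set Q}) (A : Q -> {set T})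
    (F : {set {set T}}) b c :
  (forall s : {perm T}, #|[set q in G | s @: A q \in F]| <= b) ->
  (forall Y, Y \in F -> c <= #|[set q in G | #|A q| == #|Y|]|) ->
  #|F| * c <= b * 'C(#|T|, #|T| %/ 2).
Proof.
move=> Hb Hc; rewrite -(leq_pmul2r (fact_gt0 #|T|)).
have ub : \sum_(s : {perm T}) #|[set q in G | s @: A q \in F]| <= b * #|T|`!.
  by rewrite -card_all_perm mulnC -sum_nat_const; apply: leq_sum => s _.
rewrite -[leqRHS]mulnA [X in b * X]mulnC mulnA.
apply: leq_trans (leq_mul ub (leqnn _)).
have -> : \sum_(s : {perm T}) #|[set q in G | s @: A q \in F]| =
    \sum_(Y in F) \sum_(q in G) #|[set s : {perm T} | s @: A q == Y]|.
  under [RHS]eq_bigr => Y YF.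
    under eq_bigr => q qG.
      rewrite -sum1dep_card big_mkcond /=. over.
    rewrite exchange_big /=. over.
  rewrite exchange_big /=; apply: eq_bigr => s _.
  rewrite exchange_big /= -sum1dep_card big_mkcondr /=; apply: eq_bigr => q _.
  rewrite -big_mkcondr /= sum1dep_card -[RHS]/(#|_|).
  have [AF|AF] := boolP (s @: A q \in F); [rewrite -(cards1 (s @: A q))|].
    by apply: eq_card => Y; rewrite !inE eq_sym andb_idl // => /eqP <-.
  apply/esym/eq_card0 => Y; rewrite !inE; apply/negbTE/negP=> /andP[YF /eqP AY].
  by rewrite AY YF in AF.
rewrite big_distrl /= -mulnA -sum_nat_const; apply: leq_sum => Y YF.
apply: leq_trans (leq_mul (Hc _ YF) (leqnn _)) _.
rewrite -sum_nat_const big_distrl /= [leqLHS]big_mkcond [leqRHS]big_mkcond.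
apply: leq_sum => q _; rewrite inE; case: (q \in G) => //=; case: eqP => // AY.
rewrite -(card_perm_between AY) leq_mul2l; apply/orP; right; exact: bin_le_middle.
Qed.

End Permutations.

(** * Grids of sets *)

(** Split 'I_n into blocks of sizes g i; A q is the union of the initial
    segments of lengths q i. *)
Lemma nested_blocks n (I : finType) (g : I -> nat) : \sum_i g i = n ->
  exists A : (I -> nat) -> {set 'I_n},
    (forall q, (forall i, q i <= g i) -> #|A q| = \sum_i q i)
    /\ (forall q q', (forall i, q i <= g i) ->
         A q \subset A q' <-> forall i, q i <= q' i).
Proof.
move=> gn; pose T := {i : I & 'I_(g i)}.
have cT : #|{: T}| = n.
  rewrite card_tagged sumnE big_map big_enum -gn /=.
  by apply: eq_bigr => i _; rewrite card_ord.
pose e (t : T) : 'I_n := cast_ord cT (enum_rank t).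
have e_inj : injective e by move=> t u /cast_ord_inj/enum_rank_inj.
exists (fun q => [set e t | t in [set t : T | tagged t < q (tag t)]]).
split=> [q qg | q q' qg].
  rewrite card_imset // -sum1dep_card.
  rewrite -(sig_big_dep xpredT (fun i (j : 'I_(g i)) => j < q i) (fun _ _ => 1)) /=.
  apply: eq_bigr => i _; rewrite -(big_ord_widen _ (fun=> 1)) //.
  by rewrite sum1_card card_ord.
split=> [/subsetP sub i | le_qq'].
  rewrite leqNgt; apply/negP=> lt_q'q; have lt_q'g := leq_trans lt_q'q (qg i).
  pose t : T := Tagged (fun i => 'I_(g i)) (Ordinal lt_q'g).
  have /imsetP[u] : e t \in [set e t | t in [set t : T | tagged t < q' (tag t)]].
    by apply/sub/imset_f; rewrite inE.
  by rewrite inE => + /e_inj Et; rewrite -Et /= ltnn.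
apply/imsetS/subsetP=> t; rewrite !inE => tq; exact: leq_trans tq (le_qq' _).
Qed.

(** The extension L (Some z) puts the up-set of z on top, so that L (Some x)
    puts y below x whenever x <= y fails; L None is just one
    more extension, for a coordinate that plays a special role later. Each
    order compares first by membership in the up-set, then by the size of the
    down-set, then by an arbitrary enumeration. *)
Lemma linear_extensions (disp : Order.disp_t) (P : finPOrderType disp) :
  exists (L : option P -> P -> nat) (k : nat),
    [/\ forall i, injective (L i), forall i x, L i x < k
      & forall x y, (x <= y)%O <-> forall i, L i x <= L i y].
Proof.
pose N := #|P|; pose h (x : P) := #|[set y | (y <= x)%O]|.
pose up (i : option P) (x : P) := if i is Some z then (z <= x)%O else false.
pose L (i : option P) (x : P) := (up i x * N.+1 + h x) * N + enum_rank x.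
have h_le x : h x <= N by apply: max_card.
have rk_lt (x : P) : enum_rank x < N by apply: ltn_ord.
have h_strict x y : (x < y)%O -> h x < h y.
  move=> xy; apply/proper_card/properP; split.
    apply/subsetP=> z; rewrite !inE => zx.
    exact: Order.POrderTheory.le_trans zx (Order.POrderTheory.ltW xy).
  exists y; rewrite !inE ?Order.POrderTheory.lexx //.
  by rewrite Order.POrderTheory.lt_geF.
have L_lt i x y : up i x * N.+1 + h x < up i y * N.+1 + h y -> L i x < L i y.
  move=> H; rewrite /L; have := rk_lt x; nia.
exists L, (((N.+1 + N) * N + N).+1); split=> [i x y | i x | x y].
- move/(congr1 (modn^~ N)); rewrite /L !modnMDl !modn_small //.
  by move/val_inj/enum_rank_inj.
- by rewrite /L ltnS; have := h_le x; have := rk_lt x; case: (up i x) => /=; nia.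
split=> [xy i | H].
  have [->//|nxy] := eqVneq x y.
  apply/ltnW/L_lt; have lt_xy : (x < y)%O by rewrite Order.POrderTheory.lt_neqAle nxy.
  have := h_strict x y lt_xy.
  have : up i x <= up i y.
    case: i => //= z; case zx: (z <= x)%O => //.
    by rewrite (Order.POrderTheory.le_trans zx xy).
  by case: (up i x); case: (up i y) => //=; lia.
apply/negPn/negP=> nxy; have := H (Some x); rewrite leqNgt L_lt //=.
rewrite Order.POrderTheory.lexx (negbTE nxy); have := h_le y; lia.
Qed.

Lemma sum_option (P : finType) (F : option P -> nat) :
  \sum_i F i = F None + \sum_z F (Some z).
Proof.
rewrite (bigD1 None) //= (reindex_omap Some id) => [|[]] //=.
by congr (_ + _); apply: eq_bigl => z; rewrite eqxx.
Qed.

(** The lengths in the short blocks are free: their sum never exceeds a, and the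
    long block has room for the rest. *)
Lemma many_profiles n (P : finType) (w a : nat) :
  #|P| * w <= a -> a + #|P| * w <= n ->
  w.+1 ^ #|P| <= #|[set q : {ffun option P -> 'I_n.+1} |
     [forall i, q i <= (if i is Some _ then w else n - #|P| * w)]
     && (\sum_i q i == a)]|.
Proof.
move=> wa aw; pose last_part (r : {ffun P -> 'I_w.+1}) := a - \sum_z r z.
have sum_r (r : {ffun P -> 'I_w.+1}) : \sum_z r z <= #|P| * w.
  by rewrite -sum_nat_const; apply: leq_sum => z _; rewrite -ltnS.
pose prof (r : {ffun P -> 'I_w.+1}) : {ffun option P -> 'I_n.+1} :=
  [ffun i => inord (if i is Some z then val (r z) else last_part r)].
have profS r z : prof r (Some z) = r z :> nat.
  have P_gt0 : 0 < #|P| by apply/card_gt0P; exists z.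
  have w_le_n : w <= n.
    by apply: leq_trans (leq_pmull w P_gt0) (leq_trans wa (leq_trans (leq_addr _ _) aw)).
  by rewrite ffunE inordK //; apply: leq_trans (ltn_ord _) _.
have profN r : prof r None = last_part r :> nat.
  by rewrite ffunE inordK // /last_part; lia.
have prof_inj : injective prof.
  move=> r r' /ffunP rr'; apply/ffunP=> z; apply/val_inj.
  by rewrite /= -!profS rr'.
have <- : #|prof @: [set: {ffun P -> 'I_w.+1}]| = w.+1 ^ #|P|.
  by rewrite card_imset // cardsT card_ffun card_ord.
apply/subset_leq_card/subsetP=> _ /imsetP[r _ ->]; rewrite inE; apply/andP; split.
  apply/forallP=> -[z|]; first by rewrite profS -ltnS.
  by rewrite profN /last_part; have := sum_r r; lia.
rewrite sum_option profN; under eq_bigr do rewrite profS.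
by rewrite /last_part subnK // (leq_trans (sum_r r)).
Qed.

(** * The bound *)

Lemma middle_levels_bound (disp : Order.disp_t) (P : finPOrderType disp) :
  exists C : nat, forall n (F : {set {set 'I_n}}),
    ~ contains_induced_copy P F ->
    (forall Y, Y \in F -> n %/ 3 <= #|Y| /\ #|Y| + n %/ 3 <= n) ->
    #|F| <= C * 'C(n, n %/ 2).
Proof.
have [L [k [L_inj L_lt L_le]]] := linear_extensions P.
have [C HC] := forbidden_pattern_bound L_lt #|P|.
set s := k.+2 ^ 2 in HC; pose N := #|P|.
have s_gt1 : 1 < s by rewrite (@ltn_exp2l k.+2 0 2).
clearbody s.
exists (C * (s * (3 * N.+1)) ^ N) => n F noF.
have [j jE] : exists j, j = n %/ 3 by exists (n %/ 3).
rewrite -jE => midF.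
(* Dividing by N.+1 rather than N also covers the empty poset. *)
pose w := j %/ N.+1; have wj : w * N.+1 <= j by apply: leq_divM.
have jw : j < w.+1 * N.+1 by rewrite ltn_ceil.
have Nw : N * w <= j by apply: leq_trans wj; rewrite mulnC leq_mul2l leqnSn orbT.
have Nwn : N * w <= n by lia.
pose g (i : option P) := if i is Some _ then w else n - N * w.
have gn : \sum_i g i = n by rewrite sum_option sum_nat_const subnK.
have [A [cardA subA]] := nested_blocks gn.
pose G := [set q : {ffun option P -> 'I_n.+1} | [forall i, q i <= g i]].
pose AA (q : {ffun option P -> 'I_n.+1}) := A (fun i => q i).
(* The side n + 1 is rounded up to a power of s, at the cost of a factor s. *)
pose t := up_log s n.+1.
have tn : n.+1 <= s ^ t by apply: up_logP.
have ts : s ^ t <= s * n.+1.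
  have [n0|n_gt0] := posnP n; first by rewrite /t n0 up_log1 expn0 muln1 ltnW.
  have : s ^ t.-1 < n.+1 by apply: up_log_gtn.
  have t_gt0 : 0 < t by rewrite up_log_gt0 s_gt1.
  by rewrite -{2}(prednK t_gt0) expnS => /ltnW; rewrite leq_pmul2l // ltnW.
(* For one permutation, a pattern would be an induced copy of P. *)
have few (r : {perm 'I_n}) : #|[set q in G | r @: AA q \in F]| <= C * (s ^ t) ^ N.
  apply: (HC setT n t); first by rewrite cardsT card_option.
    apply/subsetP=> q _; apply/gridP=> i; rewrite inE expn1.
    exact: leq_trans (ltn_ord _) tn.
  case=> p [pS p_lt]; apply: noF.
  have p_le x y : (r @: AA (p x) \subset r @: AA (p y)) = (x <= y)%O.
    have pxG i : p x i <= g i.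
      by have := pS x; rewrite !inE => /andP[/forallP/(_ i)].
    have -> : (r @: AA (p x) \subset r @: AA (p y)) = (AA (p x) \subset AA (p y)).
      apply/idP/idP; last exact: imsetS.
      move/subsetP=> sub; apply/subsetP=> e eA; have := sub _ (imset_f r eA).
      by rewrite mem_imset //; apply: perm_inj.
    apply/idP/idP => [/(subA _ _ pxG) H | /L_le H].
      apply/L_le => i; rewrite leqNgt; apply/negP=> Lyx.
      by have := p_lt i y x (in_setT _) Lyx; rewrite ltnNge H.
    apply/(subA _ _ pxG) => i; have := H i; rewrite leq_eqVlt.
    case/predU1P=> [/L_inj -> // | Lxy]; exact/ltnW/p_lt.
  exists (fun x => r @: AA (p x)); split=> [x y xy | x | x y].
  - by apply: Order.POrderTheory.le_anti; rewrite -!p_le xy !subxx.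
  - by have := pS x; rewrite inE => /andP[].
  by rewrite properE !p_le Order.POrderTheory.lt_leAnge.
have many Y : Y \in F -> w.+1 ^ N <= #|[set q in G | #|AA q| == #|Y|]|.
  case/midF=> jY Yj; apply: leq_trans (@many_profiles n P w #|Y| _ _) _; try (rewrite -/N; nia).
  apply/subset_leq_card/subsetP=> q; rewrite !inE => /andP[/forallP qg qY].
  rewrite cardA ?qY ?andbT //; exact/forallP.
have := permutation_averaging few many; rewrite card_ord => H.
rewrite -(@leq_pmul2r (w.+1 ^ N)) ?expn_gt0 //; apply: leq_trans H _.
rewrite [leqRHS]mulnAC leq_mul2r -[leqRHS]mulnA leq_mul2l -expnMn.
have -> : (s ^ t) ^ N <= (s * (3 * N.+1) * w.+1) ^ N; last by rewrite !orbT.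
have [->|N_gt0] := posnP N; first by rewrite !expn0.
rewrite leq_exp2r //; apply: leq_trans ts _.
rewrite -!mulnA leq_mul2l [N.+1 * _]mulnC; apply/orP; right.
by apply: (@leq_trans (3 * j.+1)); [lia | rewrite leq_mul2l jw].
Qed.

Theorem theorem1 (d : Order.disp_t) (P : finPOrderType d) :
  exists C : nat, forall n : nat, 0 < n ->
    forall F : {set {set 'I_n}}, ~ contains_induced_copy P F ->
      #|F| <= C * 'C(n, n %/ 2).
Proof.
have [C HC] := middle_levels_bound P.
exists (C + 2 + 2) => n _ F noF; pose j := n %/ 3.
have j3 : 3 * j <= n.+1 by rewrite /j; lia.
pose low := [set A in F | #|A| <= j]; pose high := [set A in F | n <= #|A| + j].
pose mid := [set A in F | (j <= #|A|) && (#|A| + j <= n)].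
have Fcover : F \subset mid :|: low :|: high.
  by apply/subsetP=> A AF; rewrite !inE AF /=; lia.
apply: leq_trans (subset_leq_card Fcover) _; rewrite !mulnDl.
apply: leq_trans (leq_card_setU _ _) _; apply: leq_add; last first.
  by apply: card_high_levels j3 _ => A; rewrite inE => /andP[].
apply: leq_trans (leq_card_setU _ _) _; apply: leq_add; last first.
  by apply: card_low_levels j3 _ => A; rewrite inE => /andP[].
apply: HC => // [[alpha [inj memF H]]|A].
  apply: noF; exists alpha; split=> // x.
  by have := memF x; rewrite inE => /andP[].
by rewrite inE => /and3P[].
Qed.
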